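(* Let $(X,d)$ be a complete metric space and let $G$ be a reflexive digraph with vertex set $V(G)=X$ and edge set $E(G)$, such that $(X,d,G)$ has property $( * )$. Let $F: X\times X \rightarrow X$ be a mapping having the mixed $G$-monotone property on $X$. Assume there exists $k < 1$ such that $$d(F(x,y), F(u,v)) \leq \frac{k}{2} \Big[d(x,u) + d(y,v)\Big]$$ for any $(x,y), (u,v) \in X\times X$ such that $\big((x,y), (u,v)\big) \in E(G)$. If there exist $x_0, y_0 \in X$ such that $\big((x_0,y_0), (F(x_0,y_0),F(y_0,x_0))\big) \in E(G)$, then there exists a coupled fixed point $(x,y)\in X\times X$ of $F$, i.e. $F(x,y) =x$ and $F(y,x) = y$.
   Context: A reflexive digraph $G$ on $X$ is a directed graph with vertex set $V(G)=X$ and no parallel edges, so that its edge set is a subset $E(G)\subseteq X\times X$, such that $(x,x)\in E(G)$ for every $x\in X$. The graph $G$ on $X$ induces a graph on $X\times X$, still denoted by $G$: for $(x,y),(u,v)\in X\times X$, $$\big((x,y),(u,v)\big)\in E(G) \iff (x,u)\in E(G) \text{ and } (v,y)\in E(G).$$ A mapping $F:X\times X\to X$ has the mixed $G$-monotone property if (1) for all $x_1,x_2,y\in X$: $(x_1,x_2)\in E(G)$ implies $(F(x_1,y),F(x_2,y))\in E(G)$; and (2) for all $x,y_1,y_2\in X$: $(y_1,y_2)\in E(G)$ implies $(F(x,y_2),F(x,y_1))\in E(G)$. $(X,d,G)$ has property $( * )$ if both of the following hold: (i) for any sequence $\{x_n\}$ in $X$ such that $(x_n,x_{n+1})\in E(G)$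 for all $n$ and $\lim_{n\to+\infty}x_n=x$, one has $(x_n,x)\in E(G)$ for all $n$; (ii) for any sequence $\{x_n\}$ in $X$ such that $(x_{n+1},x_n)\in E(G)$ for all $n$ and $\lim_{n\to+\infty}x_n=x$, one has $(x,x_n)\in E(G)$ for all $n$. *)

(* Defs.v *)
From mathcomp Require Import all_boot all_order all_algebra.
From mathcomp Require Import all_classical all_reals all_analysis.

Set Implicit Arguments.
Unset Strict Implicit.
Unset Printing Implicit Defensive.

Import Order.TTheory GRing.Theory Num.Theory.
Local Open Scope classical_set_scope.
Local Open Scope ring_scope.

(* Edges are a subset of X * X, so parallel edges are excluded by construction;
   the vertex set is the whole type X. *)
Record reflexive_digraph (X : Type) := ReflexiveDigraph {
  edges : set (X * X) ;
  edges_refl : forall x, edges (x, x)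
}.

Section Digraph.
Context {X : Type} (G : reflexive_digraph X).

(* The second component is reversed. *)
Definition prod_edges : set ((X * X) * (X * X)) :=
  [set e | edges G (e.1.1, e.2.1) /\ edges G (e.2.2, e.1.2)].

Lemma prod_edges_refl p : prod_edges (p, p).
Proof. by split; exact: edges_refl. Qed.

Definition prod_digraph : reflexive_digraph (X * X) :=
  ReflexiveDigraph prod_edges_refl.

Definition mixed_monotone (F : X * X -> X) :=
  (forall x1 x2 y, edges G (x1, x2) -> edges G (F (x1, y), F (x2, y))) /\
  (forall x y1 y2, edges G (y1, y2) -> edges G (F (x, y2), F (x, y1))).

Definition coupled_fixed_point (F : X * X -> X) (p : X * X) :=
  F p = p.1 /\ F (p.2, p.1) = p.2.

End Digraph.

(* The library's complete types and cvg ask for a pointed carrier, which a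
   metricType need not be. *)
Definition complete_metric (R : realType) (X : metricType R) :=
  forall u : nat -> X, cauchy (u @ \oo) -> exists x : X, u @ \oo --> x.

Definition property_star (R : realType) (X : metricType R)
    (G : reflexive_digraph X) :=
  (forall (u : nat -> X) (x : X),
     (forall n, edges G (u n, u n.+1)) -> u @ \oo --> x ->
     forall n, edges G (u n, x)) /\
  (forall (u : nat -> X) (x : X),
     (forall n, edges G (u n.+1, u n)) -> u @ \oo --> x ->
     forall n, edges G (x, u n)).

(* Main.v *)
Require Import Defs.
From mathcomp Require Import all_boot all_order all_algebra.
From mathcomp Require Import all_classical all_reals all_analysis.
From mathcomp Require Import lra.
Import Order.TTheory GRing.Theory Num.Theory.
Local Open Scope classical_set_scope.
Local Open Scope ring_scope.

(** Write [T (x, y) = (F (x, y), F (y, x))]; a coupled fixed point is a fixed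
    point of [T].  On the edges of the product digraph, [T] shrinks the sum
    metric [d (x, u) + d (y, v)] by the factor [k].

    The digraph is not assumed transitive, so [T] need not map edges to edges
    and the Picard iterates of [T] need not form a monotone sequence.  What
    mixed monotonicity gives is that [T] maps to an edge every edge along which
    only one coordinate moves ([coupled_map_fst], [coupled_map_snd]).  An edge
    from [(x, y)] to [(u, v)] splits into two such edges, through [(u, y)], and
    this splitting does not change the total length in the sum metric.  So the
    image under [T] of a path can be refined to a path with twice as many edges
    whose length is at most [k] times the original one.

    Concatenating the edge [p0 -> T p0] with its successive refined images
    gives one infinite path [s], whose self-similarity is the recursion
    [s (2m+1) = T (s m)], [s (2m+2) = T (fst (s (m+1)), snd (s m))].

    If [S] is the length of an initial part of the path and [e] that of its
    first edge, grouping the edges in the same way gives [S <= e + k S], hence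
    [S <= e / (1 - k)] ([self_similar_bounded_length]).  The path is therefore
    Cauchy in each coordinate.  It is monotone, so the star property gives an
    edge from each [s m] to the limit [p].  The contraction then yields
    [T (s m) --> T p], whereas [T (s m) = s (2m+1) --> p]. *)

(** * Recursion along halves *)

Lemma half_le n : (n./2 <= n)%N.
Proof. by rewrite leq_half_double -addnn leqW ?leq_addr. Qed.

Lemma uphalf_le n : (uphalf n <= n)%N.
Proof. by rewrite leq_uphalf_double -addnn leq_addr. Qed.

(** The value at [n.+1] depends on values at smaller indices that are not
    immediate predecessors; iterating the recursion step [n.+1] times from a
    constant sequence determines the value at [n]. *)
Lemma halving_recursion {T : Type} (g : T -> T -> T) (z : T) :
  exists s : nat -> T,
    s 0%N = z /\ forall n, s n.+1 = g (s (uphalf n)) (s n./2).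
Proof.
pose step (s : nat -> T) n :=
  if n is m.+1 then g (s (uphalf m)) (s m./2) else z.
pose it j := iter j step (fun=> z).
have itS j n : it j.+1 n.+1 = g (it j (uphalf n)) (it j n./2) by [].
have it_stable n i j : (n < i)%N -> (n < j)%N -> it i n = it j n.
  elim/ltn_ind: n i j => -[|n] IH [|i] [|j] // ni nj.
  have [un hn] := (uphalf_le n, half_le n).
  rewrite !itS; congr g; apply: IH;
    by rewrite ?ltnS// (leq_ltn_trans un, leq_ltn_trans hn).
exists (fun n => it n.+1 n); split=> [//|n].
by rewrite itS; congr g; apply: it_stable; rewrite // ltnS ?half_le ?uphalf_le.
Qed.

(** * Sequences in a metric space *)

Section Metric.
Context {R : realType} {X : metricType R}.
Implicit Types (u v w : nat -> X) (x y z : X).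

Lemma mdist_le_sum u m n : (m <= n)%N ->
  mdist (u m) (u n) <= \sum_(m <= i < n) mdist (u i) (u i.+1).
Proof.
elim: n => [|n IH]; first by rewrite leqn0 => /eqP ->; rewrite big_geq// mdistxx.
rewrite leq_eqVlt => /predU1P[->|]; first by rewrite big_geq// mdistxx.
rewrite ltnS => mn; rewrite big_nat_recr//=.
by apply: (le_trans (metric_triangle _ (u n) _)); rewrite lerD2r IH.
Qed.

Lemma cauchy_of_bounded_length u (M : R) :
  (forall n, \sum_(0 <= i < n) mdist (u i) (u i.+1) <= M) -> cauchy (u @ \oo).
Proof.
move=> uM; pose S n := \sum_(0 <= i < n) mdist (u i) (u i.+1).
have S_nd : nondecreasing_seq S.
  apply/nondecreasing_seqP => n.
  by rewrite /S big_nat_recr//= lerDl mdist_ge0.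
have cS : cvgn S.
  by apply: nondecreasing_is_cvgn => //; exists M => _ [n _ <-]; exact: uM.
apply: cauchy_exP => e e0.
have /cvgrPdist_lt/(_ _ e0) [N _ /(_ N (leqnn _))/= SN] := cS.
exists (u N); exists N => // n /= Nn; rewrite ballEmdist/=.
apply: le_lt_trans SN; apply: le_trans (mdist_le_sum u _ _ Nn) _.
apply: le_trans (ler_norm _).
rewrite lerBrDl -[leLHS]/(S N + _) /S -big_cat_nat//=.
exact: (nondecreasing_cvgn_le S_nd cS).
Qed.

Lemma cvg_of_mdist_le u v w x y z (c : R) :
  u @ \oo --> x -> v @ \oo --> y ->
  (forall n, mdist (w n) z <= c * (mdist (u n) x + mdist (v n) y)) ->
  w @ \oo --> z.
Proof.
move=> ux vy wz; apply/metricType_numDomainType.cvgrPdist_lt => e e0.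
(* [c] may be negative; [c'] is a positive upper bound of it *)
pose c' := Num.max c 1.
have c'0 : 0 < c' by rewrite lt_max ltr01 orbT.
have e2 : 0 < e / c' / 2 by rewrite !divr_gt0.
near=> n.
have un : mdist x (u n) < e / c' / 2.
  by near: n; exact: metricType_numDomainType.cvgr_dist_lt.
have vn : mdist y (v n) < e / c' / 2.
  by near: n; exact: metricType_numDomainType.cvgr_dist_lt.
rewrite metric_sym; apply: le_lt_trans (wz n) _.
apply: (@le_lt_trans _ _ (c' * (mdist (u n) x + mdist (v n) y))).
  by rewrite ler_wpM2r ?addr_ge0 ?mdist_ge0// le_max lexx.
rewrite mulrC -ltr_pdivlMr// (metric_sym (u n)) (metric_sym (v n)).
by rewrite [ltRHS]splitr ltrD.
Unshelve. all: by end_near. Qed.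

End Metric.

(** * The self-similar path *)

Definition coupled_map {X : Type} (F : X * X -> X) (p : X * X) : X * X :=
  (F p, F (p.2, p.1)).

Definition sum_dist {R : realType} {X : metricType R} (p q : X * X) : R :=
  mdist p.1 q.1 + mdist p.2 q.2.

Section Path.
Context {X : Type} {G : reflexive_digraph X} {F : X * X -> X}.
Local Notation T := (coupled_map F).

(** The even positive terms are the images of the intermediate points inserted
    in the edges from [s m] to [s m.+1]. *)
Definition self_similar (s : nat -> X * X) :=
  (forall m, s m.*2.+1 = T (s m)) /\
  (forall m, s m.*2.+2 = T ((s m.+1).1, (s m).2)).

Lemma self_similar_exists p : exists2 s, s 0%N = p & self_similar s.
Proof.
have [s [s0 sS]] := halving_recursion (fun q r => T (q.1, r.2)) p.
exists s => //; split=> m; rewrite sS.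
  by rewrite uphalf_double doubleK -surjective_pairing.
by rewrite /= uphalf_double doubleK.
Qed.

Hypothesis FG : mixed_monotone G F.

(** Moving [a] alone moves the first argument of [F] in one coordinate of [T]
    and the second argument in the other, so each coordinate needs only one of
    the two monotonicity conditions; moving both would need their composite. *)
Lemma coupled_map_fst a a' b : edges G (a, a') ->
  prod_edges G (T (a, b), T (a', b)).
Proof. by move=> aa'; split=> /=; [apply: FG.1|apply: FG.2]. Qed.

Lemma coupled_map_snd a b b' : edges G (b', b) ->
  prod_edges G (T (a, b), T (a, b')).
Proof. by move=> bb'; split=> /=; [apply: FG.2|apply: FG.1]. Qed.

(** Edge [2m+1] is the image of the half of edge [m] along which the first
    coordinate moves, and edge [2m+2] the image of the other half. *)
Lemma self_similar_edges s : self_similar s ->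
  prod_edges G (s 0%N, T (s 0%N)) -> forall n, prod_edges G (s n, s n.+1).
Proof.
move=> [s1 s2] s0; elim/ltn_ind => -[|n] IH; first by rewrite (s1 0%N).
have [IH1 IH2] := IH _ (half_le n : (n./2 < n.+1)%N).
move: (odd_double_half n) IH1 IH2; case: (odd n) => <-;
  rewrite ?half_bit_double /= => IH1 IH2.
- rewrite s2 -doubleS s1 [s _.+1]surjective_pairing; exact: coupled_map_snd.
- rewrite s1 s2 [s _]surjective_pairing; exact: coupled_map_fst.
Qed.

End Path.

Section Contraction.
Context {R : realType} {X : metricType R} {G : reflexive_digraph X}.
Context {F : X * X -> X} {k : R}.
Local Notation T := (coupled_map F).
Hypothesis Fk : forall x y u v : X, edges (prod_digraph G) ((x, y), (u, v)) ->
  mdist (F (x, y)) (F (u, v)) <= k / 2 * (mdist x u + mdist y v).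

(** The edge from [(x, y)] to [(u, v)] is also an edge from [(v, u)] to
    [(y, x)], so the hypothesis bounds both coordinates. *)
Lemma coupled_map_contraction p q : prod_edges G (p, q) ->
  sum_dist (T p) (T q) <= k * sum_dist p q.
Proof.
case: p q => [x y] [u v] [/= xu vy].
have h1 := Fk _ _ _ _ (conj xu vy : edges (prod_digraph G) ((x, y), (u, v))).
have h2 := Fk _ _ _ _ (conj vy xu : edges (prod_digraph G) ((v, u), (y, x))).
rewrite /sum_dist /= (metric_sym (F (y, x))).
move: h2; rewrite (metric_sym u) (metric_sym v); lra.
Qed.

(** Grouping the edges [2m+1] and [2m+2], whose lengths are at most [k] times
    the displacements of the two coordinates along edge [m], bounds the length
    of the path by its first edge plus [k] times its own length. *)
Lemma self_similar_bounded_length s : k < 1 -> self_similar (F := F) s ->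
  (forall n, prod_edges G (s n, s n.+1)) ->
  forall n, \sum_(0 <= i < n) sum_dist (s i) (s i.+1) <=
            sum_dist (s 0%N) (s 1%N) / (1 - k).
Proof.
move=> k1 [s1 s2] sG n; pose e i := sum_dist (s i) (s i.+1).
have e0 i : 0 <= e i by rewrite addr_ge0 ?mdist_ge0.
have e12 m : e m.*2.+1 + e m.*2.+2 <= k * e m.
  have [aa' b'b] := sG m.
  rewrite /e s2 -doubleS !s1 mulrDr lerD//.
    rewrite [s m]surjective_pairing.
    apply: le_trans (coupled_map_contraction _ _ _) _.
      by split=> //=; exact: edges_refl.
    by rewrite /sum_dist /= mdistxx addr0.
  rewrite [X in T X]surjective_pairing [X in _ (T X)]surjective_pairing.
  apply: le_trans (coupled_map_contraction _ _ _) _.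
    by split=> //=; exact: edges_refl.
  by rewrite /sum_dist /= mdistxx add0r.
pose S n := \sum_(0 <= i < n) e i.
have SS i : S i.+1 = S i + e i by rewrite /S big_nat_recr.
have S2 m : S m.*2.+1 <= e 0%N + k * S m.
  elim: m => [|m IH]; first by rewrite /S big_nat1 big_geq// mulr0 addr0.
  by rewrite doubleS !(SS _.+1) (SS m); have := e12 m; lra.
rewrite ler_pdivlMr ?subr_gt0// -/(S n) -/(e 0%N).
suff : S n <= S n.*2.+1 by have := S2 n; lra.
have n2 : (n <= n.*2.+1)%N by rewrite leqW// -addnn leq_addr.
by rewrite /S (big_cat_nat _ n2)//= lerDl sumr_ge0.
Qed.

End Contraction.

(** * Coupled fixed points *)

Theorem theorem3p2 (R : realType) (X : metricType R)
    (G : reflexive_digraph X) (F : X * X -> X) :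
  complete_metric X ->
  property_star G ->
  mixed_monotone G F ->
  (exists2 k : R, k < 1 &
     forall x y u v : X, edges (prod_digraph G) ((x, y), (u, v)) ->
       mdist (F (x, y)) (F (u, v)) <= k / 2 * (mdist x u + mdist y v)) ->
  (exists x0 y0 : X,
     edges (prod_digraph G) ((x0, y0), (F (x0, y0), F (y0, x0)))) ->
  exists p : X * X, coupled_fixed_point F p.
Proof.
move=> Xcomplete [Gup Gdown] FG [k k1 Fk] [x0 [y0 p0]].
have [s s0 ss] := self_similar_exists (F := F) (x0, y0).
have sG : forall n, prod_edges G (s n, s n.+1).
  by apply: (self_similar_edges FG s ss); rewrite s0.
have sM := self_similar_bounded_length Fk _ k1 ss sG.
have [x sx] : exists x : X, (fst \o s) @ \oo --> x.
  apply: Xcomplete; apply: cauchy_of_bounded_length => n.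
  apply: le_trans (sM n).
  by apply: ler_sum => i _; rewrite /sum_dist lerDl mdist_ge0.
have [y sy] : exists y : X, (snd \o s) @ \oo --> y.
  apply: Xcomplete; apply: cauchy_of_bounded_length => n.
  apply: le_trans (sM n).
  by apply: ler_sum => i _; rewrite /sum_dist lerDr mdist_ge0.
have sp n : prod_edges G (s n, (x, y)).
  by split; [apply: (Gup _ _ _ sx)|apply: (Gdown _ _ _ sy)] => i; have [] := sG i.
have Ts n : sum_dist (coupled_map F (s n)) (coupled_map F (x, y)) <=
    k * (mdist ((fst \o s) n) x + mdist ((snd \o s) n) y).
  exact: (coupled_map_contraction Fk).
have odd_cvg (u : nat -> X) (l : X) :
    u @ \oo --> l -> (fun m => u m.*2.+1) @ \oo --> l.
  apply: cvg_comp; apply/cvgnyPge => N; exists N => // m /= Nm.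
  by rewrite leqW// -addnn (leq_trans Nm)// leq_addr.
(* [x] and [F (x, y)] are both limits of the first coordinates at odd indices,
   [y] and [F (y, x)] of the second ones *)
exists (x, y); split=> /=.
- apply: (@cvg_unique _ (@metric_hausdorff _ X)) (odd_cvg _ _ sx).
  apply: (cvg_of_mdist_le _ _ _ _ _ _ _ sx sy) => n; apply: le_trans (Ts n).
  by rewrite /= ss.1 /sum_dist lerDl mdist_ge0.
- apply: (@cvg_unique _ (@metric_hausdorff _ X)) (odd_cvg _ _ sy).
  apply: (cvg_of_mdist_le _ _ _ _ _ _ _ sx sy) => n; apply: le_trans (Ts n).
  by rewrite /= ss.1 /sum_dist lerDr mdist_ge0.
Qed.
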